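(* Let $g=(g_1,\dots,g_p):\mathbb{R}^n\to\mathbb{R}^p$ have $C^{1,1}$ components, let $X=\{x\in\mathbb{R}^n : g_i(x)\le 0,\ i=1,\dots,p\}$, let $\bar x\in X$ and $u\in\mathbb{R}^n$. Suppose that the system (in the unknown $w\in\mathbb{R}^n$) $$\langle\nabla g_i(\bar x),w\rangle+\langle\zeta^{*i},u\rangle<0,\qquad i\in I(\bar x;u),$$ has at least one solution, where $I(\bar x;u)=\{i\in I(\bar x) : \langle\nabla g_i(\bar x),u\rangle=0\}$. Then the Abadie second-order constraint qualification holds at $\bar x$ with respect to $u$, that is, $$L^2(X;\bar x,u)\subset T^2(X;\bar x,u).$$
   Context: A real-valued function on $\mathbb{R}^n$ is $C^{1,1}$ if it is Fréchet differentiable with locally Lipschitz gradient. Normal cones: for nonempty $\Omega\subset\mathbb{R}^N$ and $z\in\Omega$, $\widehat N(z,\Omega)=\{v : \limsup_{z'\to z,\ z'\in\Omega}\langle v,z'-z\rangle/\|z'-z\|\le 0\}$, and $N(z,\Omega)$ (the limiting/Mordukhovich normal cone) is the set of all $v$ for which there are $z_k\in\Omega$, $z_k\to z$, and $v_k\to v$ with $v_k\in\widehat N(z_k,\Omega)$ for all $k$. Limiting second-order subdifferential: for $\varphi\in C^{1,1}(\mathbb{R}^n)$ and $x,u\in\mathbb{R}^n$, $\partial^2\varphi(x)(u)=\{v\in\mathbb{R}^n : (v,-u)\in N((x,\nabla\varphi(x)),\mathrm{gph}\,\nabla\varphi)\}$; this equals the limiting subdifferential at $x$ of the locally Lipschitz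 scalar function $\langle u,\nabla\varphi(\cdot)\rangle$, where the limiting subdifferential of $\psi$ at $x$ is $\partial\psi(x)=\{x^* : (x^*,-1)\in N((x,\psi(x)),\mathrm{epi}\,\psi)\}$. The set $\partial^2\varphi(x)(u)$ is nonempty and compact. Second-order tangent set: for $\Omega\subset\mathbb{R}^n$, $\bar x\in\Omega$, $u\in\mathbb{R}^n$, $$T^2(\Omega;\bar x,u)=\{v\in\mathbb{R}^n : \exists t_k\downarrow 0,\ \exists v^k\to v,\ \bar x+t_ku+\tfrac12t_k^2v^k\in\Omega\ \ \forall k\in\mathbb{N}\}.$$ Lexicographic order on $\mathbb{R}^2$: $(a_1,a_2)\leqq_{\rm lex}(b_1,b_2)$ iff $a_1<b_1$, or $a_1=b_1$ and $a_2\le b_2$. Active index set: $I(\bar x)=\{i\in\{1,\dots,p\} : g_i(\bar x)=0\}$. For given $u$, let $\zeta^{*i}\in\partial^2g_i(\bar x)(u)$ be an element with $\langle\zeta^{*i},u\rangle=\max\{\langle\zeta,u\rangle : \zeta\in\partial^2g_i(\bar x)(u)\}$. Put $$G_i^{2}(u,v)=\big(\langle\nabla g_i(\bar x),u\rangle,\ \langle\nabla g_i(\bar x),v\rangle+\langle\zeta^{*i},u\rangle\big),$$ $$L^{2}(X;\bar x,u)=\{v\in\mathbb{R}^n : G_i^{2}(u,v)\leqq_{\rm lex}(0,0)\ \ \forall i\in I(\bar x)\}.$$ *)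

(* Defs.v *)
From mathcomp Require Import all_boot all_order all_algebra.
From mathcomp Require Import all_classical all_reals all_analysis.

Set Implicit Arguments.
Unset Strict Implicit.
Unset Printing Implicit Defensive.

Import Order.TTheory GRing.Theory Num.Theory.
Import numFieldNormedType.Exports.

Local Open Scope classical_set_scope.
Local Open Scope ring_scope.

(* MathComp-Analysis equips 'rV[R]_n with the sup norm; [enorm] is the Euclidean
   norm. Limits, differentiability and local Lipschitz continuity in R^n do not
   depend on which of the two is used. *)
Definition dotp (R : realType) (n : nat) (x y : 'rV[R]_n) : R :=
  \sum_(j < n) x 0 j * y 0 j.

Definition enorm (R : realType) (n : nat) (x : 'rV[R]_n) : R :=
  Num.sqrt (dotp x x).

Definition grad (R : realType) (n : nat) (f : 'rV[R]_n -> R) (x : 'rV[R]_n) :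
    'rV[R]_n :=
  \row_j 'd f x (delta_mx 0 j).

Definition C11 (R : realType) (n : nat) (f : 'rV[R]_n -> R) : Prop :=
  (forall x : 'rV[R]_n, differentiable f x) /\
  (forall x : 'rV[R]_n, exists2 U : set 'rV[R]_n,
     nbhs x U & [lipschitz grad f y | y in U]).

(* The upper limit is over z' -> z with z' in Omega and z' != z. At an isolated
   point of Omega the filter contains set0 and the upper limit is -oo. *)
Definition frechet_normal_cone (R : realType) (N : nat) (z : 'rV[R]_N)
    (Omega : set 'rV[R]_N) : set 'rV[R]_N :=
  [set v : 'rV[R]_N | (limf_esup (fun z' : 'rV[R]_N =>
                 (dotp v (z' - z) / enorm (z' - z))%:E)
              (within Omega z^') <= 0)%E].

Definition limiting_normal_cone (R : realType) (N : nat) (z : 'rV[R]_N)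
    (Omega : set 'rV[R]_N) : set 'rV[R]_N :=
  [set v | exists z_ v_ : nat -> 'rV[R]_N,
     [/\ forall k, Omega (z_ k), z_ @ \oo --> z, v_ @ \oo --> v &
         forall k, frechet_normal_cone (z_ k) Omega (v_ k)]].

(* Pairs in R^n x R^n are encoded as concatenated rows in R^(n + n). *)
Definition gph (R : realType) (n : nat) (F : 'rV[R]_n -> 'rV[R]_n) :
    set 'rV[R]_(n + n) :=
  [set row_mx x (F x) | x in setT].

Definition subdiff2 (R : realType) (n : nat) (phi : 'rV[R]_n -> R)
    (x u : 'rV[R]_n) : set 'rV[R]_n :=
  [set v | limiting_normal_cone (row_mx x (grad phi x)) (gph (grad phi))
             (row_mx v (- u))].

(* Adding that t_ is nonincreasing to t_ k > 0, t_ --> 0 does not change the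
   set, by extraction of a subsequence. *)
Definition tangent2 (R : realType) (n : nat) (Omega : set 'rV[R]_n)
    (xbar u : 'rV[R]_n) : set 'rV[R]_n :=
  [set v | exists (t_ : nat -> R) (v_ : nat -> 'rV[R]_n),
     [/\ forall k, 0 < t_ k, nonincreasing_seq t_, t_ @ \oo --> (0 : R),
         v_ @ \oo --> v &
         forall k, Omega (xbar + t_ k *: u + (2^-1 * t_ k ^+ 2) *: v_ k)]].

Definition feasible (R : realType) (n p : nat) (g : 'I_p -> 'rV[R]_n -> R) :
    set 'rV[R]_n :=
  [set x | forall i, g i x <= 0].

Definition active (R : realType) (n p : nat) (g : 'I_p -> 'rV[R]_n -> R)
    (xbar : 'rV[R]_n) : set 'I_p :=
  [set i | g i xbar = 0].

Definition active_dir (R : realType) (n p : nat) (g : 'I_p -> 'rV[R]_n -> R)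
    (xbar u : 'rV[R]_n) : set 'I_p :=
  [set i | active g xbar i /\ dotp (grad (g i) xbar) u = 0].

Definition is_max_subgrad2 (R : realType) (n : nat) (phi : 'rV[R]_n -> R)
    (x u zeta : 'rV[R]_n) : Prop :=
  subdiff2 phi x u zeta /\
  (forall xi, subdiff2 phi x u xi -> dotp xi u <= dotp zeta u).

Definition G2 (R : realType) (n p : nat) (g : 'I_p -> 'rV[R]_n -> R)
    (zeta : 'I_p -> 'rV[R]_n) (xbar : 'rV[R]_n) (i : 'I_p)
    (u v : 'rV[R]_n) : R *l R :=
  (dotp (grad (g i) xbar) u, dotp (grad (g i) xbar) v + dotp (zeta i) u).

Definition L2 (R : realType) (n p : nat) (g : 'I_p -> 'rV[R]_n -> R)
    (zeta : 'I_p -> 'rV[R]_n) (xbar u : 'rV[R]_n) : set 'rV[R]_n :=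
  [set v | forall i, active g xbar i ->
     (G2 g zeta xbar i u v <= (0, 0))%O].

(* Main.v *)
Require Import Defs.
From mathcomp Require Import all_boot all_order all_algebra.
From mathcomp Require Import all_classical all_reals all_analysis.
From mathcomp Require Import ring lra.
Import numFieldNormedType.Exports.
Import Order.TTheory GRing.Theory Num.Theory.
Local Open Scope classical_set_scope.
Local Open Scope ring_scope.

(* Along the arc c(t) = xbar + t u + t^2/2 w the derivative of [g i \o c] is
   <grad g_i(c(t)), u> + t <grad g_i(c(t)), w>. Since the gradient is locally
   Lipschitz, for directionally active [i] this is at most
   t (<grad g_i(xbar), w> + <zeta_i, u> + o(1)) as soon as the scalarised
   gradient psi = <u, grad g_i(.)> satisfies
   psi(xbar + t u) - psi(xbar) <= t (<zeta_i, u> + o(1)).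
   The latter is a mean value inequality: if psi grows faster than slope m on a
   segment, minimising psi minus a suitable increasing function of the coordinate
   along u, plus a quadratic penalty across u, over a tube around the segment
   yields a proximal subgradient v of psi with <v, u> >= m; such v give Frechet
   normals (v, -u) to the graph of the gradient, and a cluster point of them lies
   in the second-order subdifferential, contradicting the maximality of zeta_i.
   Hence strict solutions w make the arc feasible for small t, and any v in
   L^2 is a limit of strict solutions v + (w - v)/(k + 1). *)

(** * The inner product and the sup norm *)

Section Dotp.
Context {R : realType} {n : nat}.
Implicit Types (x y z : 'rV[R]_n) (a : R).

Lemma dotpC x y : dotp x y = dotp y x.
Proof. by apply: eq_bigr => j _; rewrite mulrC. Qed.

Lemma dotpDl x y z : dotp (x + y) z = dotp x z + dotp y z.
Proof. by rewrite -big_split; apply: eq_bigr => j _; rewrite mxE mulrDl. Qed.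

Lemma dotpZl a x y : dotp (a *: x) y = a * dotp x y.
Proof. by rewrite /dotp mulr_sumr; apply: eq_bigr => j _; rewrite mxE mulrA. Qed.

Lemma dotpNl x y : dotp (- x) y = - dotp x y.
Proof. by rewrite -scaleN1r dotpZl mulN1r. Qed.

Lemma dotpDr x y z : dotp x (y + z) = dotp x y + dotp x z.
Proof. by rewrite dotpC dotpDl !(dotpC x). Qed.

Lemma dotpZr a x y : dotp x (a *: y) = a * dotp x y.
Proof. by rewrite dotpC dotpZl dotpC. Qed.

Lemma dotpNr x y : dotp x (- y) = - dotp x y.
Proof. by rewrite dotpC dotpNl dotpC. Qed.

Lemma coord_le_norm x j : `|x 0 j| <= `|x|.
Proof.
rewrite [leRHS]/Num.Def.normr /= mx_normrE.
exact: (le_bigmax _ (fun ij : 'I_1 * 'I_n => `|x ij.1 ij.2|) (0, j)).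
Qed.

Lemma norm_coord x : x != 0 -> exists j, `|x| = `|x 0 j|.
Proof.
move=> x0; have /mx_norm_neq0[[i j] /= xij] : mx_norm x != 0.
  by apply: contra x0 => /eqP/mx_norm_eq0 ->.
by exists j; rewrite -[0](ord1 i).
Qed.

Lemma sqr_norm_le_dotp x : `|x| ^+ 2 <= dotp x x.
Proof.
have [->|/norm_coord[j ->]] := eqVneq x 0.
  by rewrite normr0 expr0n sumr_ge0 // => j _; rewrite -expr2 sqr_ge0.
rewrite /dotp (bigD1 j) //= real_normK ?num_real // expr2 lerDl.
by apply: sumr_ge0 => i _; rewrite -expr2 sqr_ge0.
Qed.

Lemma norm_le_enorm x : `|x| <= enorm x.
Proof.
rewrite -[leLHS]ger0_norm // -sqrtr_sqr; apply: ler_wsqrtr.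
exact: sqr_norm_le_dotp.
Qed.

(** Sup-norm substitute for the Cauchy-Schwarz inequality, at the cost of the factor [n]. *)
Lemma norm_dotp_le x y : `|dotp x y| <= n%:R * `|x| * `|y|.
Proof.
apply: le_trans (ler_norm_sum _ _ _) _.
have -> : n%:R * `|x| * `|y| = \sum_(j < n) `|x| * `|y|.
  by rewrite sumr_const card_ord -mulrA mulr_natl.
by apply: ler_sum => j _; rewrite normrM ler_pM // coord_le_norm.
Qed.

Lemma cvg_dotp {T : Type} {F : set_system T} {FF : Filter F}
    (f h : T -> 'rV[R]_n) x y :
  f @ F --> x -> h @ F --> y -> (fun t => dotp (f t) (h t)) @ F --> dotp x y.
Proof.
move=> fx hy; rewrite /dotp.
apply: cvg_big => [|j _].
  exact: add_continuous.
have cvg_coord (k : T -> 'rV[R]_n) (z : 'rV[R]_n) :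
    k @ F --> z -> (fun t => k t 0 j) @ F --> z 0 j.
  move=> kz; apply: (cvg_comp _ (fun M : 'rV[R]_n => M 0 j) kz).
  exact: coord_continuous.
by apply: (@cvgM _ _ _ _ (fun t => f t 0 j) (fun t => h t 0 j)); exact: cvg_coord.
Qed.
End Dotp.
Arguments cvg_dotp {R n T F FF f h x y}.

Lemma dotp_row_mx (R : realType) (m n : nat) (a c : 'rV[R]_m) (b d : 'rV[R]_n) :
  dotp (row_mx a b) (row_mx c d) = dotp a c + dotp b d.
Proof.
rewrite /dotp big_split_ord /=; congr (_ + _); apply: eq_bigr => j _.
  by rewrite !row_mxEl.
by rewrite !row_mxEr.
Qed.

Lemma norm_row_mxl (R : realType) (m n : nat) (a : 'rV[R]_m) (b : 'rV[R]_n) :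
  `|a| <= `|row_mx a b|.
Proof.
have [->|/norm_coord[j ->]] := eqVneq a 0; first by rewrite normr0.
by rewrite -(row_mxEl a b) coord_le_norm.
Qed.

Lemma grad_dotp (R : realType) (n : nat) (f : 'rV[R]_n -> R) x d :
  differentiable f x -> 'd f x d = dotp (grad f x) d.
Proof.
move=> dfx; rewrite {1}[d]row_sum_delta linear_sum /=.
by apply: eq_bigr => j _; rewrite linearZ /= mxE mulrC.
Qed.

(** * Proximal subgradients and normals to a graph *)

Definition prox_subgrad {R : realType} {n : nat} (f : 'rV[R]_n -> R)
    (z v : 'rV[R]_n) : Prop :=
  exists2 K : R, 0 <= K &
  \forall y \near z, f z + dotp v (y - z) - K * `|y - z| ^+ 2 <= f y.

(** The proximal inequality bounds the numerator [<v, y - z> - <u, F y - F z>] by [K |y - z|^2], and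
    [|y - z|] is at most the Euclidean distance of the two graph points. The quotient is thus at
    most [K |y - z|], which tends to 0. *)
Lemma prox_subgrad_frechet_normal (R : realType) (n : nat)
    (F : 'rV[R]_n -> 'rV[R]_n) (u z v : 'rV[R]_n) :
  prox_subgrad (fun y => dotp u (F y)) z v ->
  frechet_normal_cone (row_mx z (F z)) (gph F) (row_mx v (- u)).
Proof.
move=> [K K0 /nbhs_ballP[d /= d0 dK]]; rewrite /frechet_normal_cone /=.
apply/lee_addgt0Pr => e e0; rewrite add0e.
pose c := Num.min d (e / (K + 1)).
have K1 : 0 < K + 1 by rewrite ltr_wpDl.
have c0 : 0 < c by rewrite lt_min d0 divr_gt0.
set rat := fun z' : 'rV_ _ => _.
(* The upper limit is an infimum of suprema over sets of the filter, so it is enough that the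
   sublevel set of [rat] at [e] belongs to the filter. *)
apply: (@le_trans _ _ (ereal_sup (rat @` [set q | (rat q <= e%:E)%E]))).
  apply: ereal_inf_lbound; exists [set q | (rat q <= e%:E)%E] => //.
  apply/nbhs_ballP; exists c => //= q; rewrite -ball_normE /= => qc _ [y _ yq].
  rewrite /rat /= lee_fin -yq.
  have -> : row_mx y (F y) - row_mx z (F z) = row_mx (y - z) (F y - F z).
    by rewrite opp_row_mx add_row_mx.
  set E := enorm _.
  have yzE : `|y - z| <= E.
    exact: le_trans (norm_row_mxl _ _ _ _ _) (norm_le_enorm _).
  have yzc : `|y - z| < c.
    apply: le_lt_trans qc; rewrite -yq distrC opp_row_mx add_row_mx.
    exact: norm_row_mxl.
  have E0 : 0 <= E by rewrite sqrtr_ge0.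
  (* For [E = 0] the quotient is 0 by the convention on inverses. *)
  have [->|En0] := eqVneq E 0; first by rewrite invr0 mulr0 ltW.
  rewrite ler_pdivrMr ?lt_def ?En0 //.
  have /dK /= : ball z d y.
    by rewrite -ball_normE /= distrC; apply: lt_le_trans yzc _; rewrite ge_min lexx.
  rewrite dotp_row_mx dotpNl [dotp u (_ - _)]dotpDr dotpNr.
  have : K * `|y - z| ^+ 2 <= e * E.
    have h1 : (K + 1) * `|y - z| <= e.
      rewrite mulrC -ler_pdivlMr //; apply: ltW; apply: lt_le_trans yzc _.
      by rewrite ge_min lexx orbT.
    rewrite expr2 mulrA; apply: ler_pM => //; first by rewrite mulr_ge0.
    by apply: le_trans h1; rewrite mulrDl mul1r lerDl.
  by lra.
by apply: ge_ereal_sup => _ [q /= ? <-].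
Qed.

(** * A mean value inequality for proximal subgradients *)

Section MeanValue.
Context {R : realType} {n : nat}.
Variables (x u : 'rV[R]_n).
Hypothesis u0 : u != 0.
Implicit Types (y z d : 'rV[R]_n).

Let U := dotp u u.

Let U_gt0 : 0 < U.
Proof.
by apply: lt_le_trans (sqr_norm_le_dotp u); rewrite exprn_gt0 // normr_gt0.
Qed.

(** Orthogonal splitting relative to the line through [x] in direction [u]:
    [y - x = along y *: u + across y]. *)
Definition along y : R := dotp (y - x) u / U.
Definition across y : 'rV[R]_n := y - x - along y *: u.

Lemma dotp_across y : dotp (across y) u = 0.
Proof.
by rewrite /across dotpDl dotpNl dotpZl /along divfK ?gt_eqF // subrr.
Qed.

Lemma alongD y d : along (y + d) = along y + dotp d u / U.
Proof. by rewrite /along -mulrDl -dotpDl addrAC. Qed.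

Lemma acrossD y d : across (y + d) = across y + (d - (dotp d u / U) *: u).
Proof. by rewrite /across alongD scalerDl opprD (addrAC y) addrACA. Qed.

Lemma along_line t : along (x + t *: u) = t.
Proof. by rewrite /along addrC addKr dotpZl mulfK ?gt_eqF. Qed.

Lemma across_line t : across (x + t *: u) = 0.
Proof. by rewrite /across along_line [x + _]addrC addrK subrr. Qed.

Lemma sqr_acrossD y d :
  dotp (across (y + d)) (across (y + d)) =
  dotp (across y) (across y) + 2 * dotp (across y) d
    + (dotp d d - (dotp d u / U) ^+ 2 * U).
Proof.
have : dotp d u / U * U = dotp d u by rewrite divfK ?gt_eqF.
rewrite acrossD; move: (dotp d u / U) => t tU.
have := dotp_across y; move: (across y) => w wu.
rewrite !(dotpDl, dotpDr, dotpNl, dotpNr, dotpZl, dotpZr).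
rewrite (dotpC d w) (dotpC u w) (dotpC u d) wu -/U -tU; ring.
Qed.

Lemma along_cvg z : along y @[y --> z] --> along z.
Proof.
exact: (cvgMr_tmp (cvg_dotp (cvgB cvg_id (cvg_cst x)) (cvg_cst u))).
Qed.

Lemma across_cvg z : across y @[y --> z] --> across z.
Proof.
exact: (cvgB (cvgB cvg_id (cvg_cst x)) (cvgZr_tmp (along_cvg z))).
Qed.

(* The penalty [k / (1 + N tau)] is convex with derivative [- k N] at 0 and
   bounded by [k]: it repels minimisers from the face [tau = 0] although its
   total variation is small. *)
Definition tilted (f : 'rV[R]_n -> R) (m k N lam : R) y : R :=
  f y - m * along y + k / (1 + N * along y)
    + lam * dotp (across y) (across y).

(** At a local minimiser of [f] plus a smooth term, minus the gradient of that term is a proximal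
    subgradient of [f]. Its [u]-component is [m] plus the positive contribution of the decreasing
    penalty; the part across [u] is orthogonal to [u]. *)
Lemma prox_subgrad_tilted (f : 'rV[R]_n -> R) (m k N lam : R) z :
  0 < k -> 0 < N -> 0 < lam -> 0 < along z ->
  (\forall y \near z, tilted f m k N lam z <= tilted f m k N lam y) ->
  exists2 v, prox_subgrad f z v & m <= dotp v u.
Proof.
move=> k0 N0 lam0 z0 zmin.
have Naz : 0 < 1 + N * along z by rewrite addr_gt0 // mulr_gt0.
pose c := m + k * N / (1 + N * along z) ^+ 2.
exists ((c / U) *: u - (2 * lam) *: across z); last first.
  rewrite dotpDl dotpNl !dotpZl dotp_across mulr0 subr0 divfK ?gt_eqF //.
  by rewrite /c lerDl divr_ge0 ?sqr_ge0 // mulr_ge0 ?ltW.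
(* [C] is a Lipschitz constant of [along]; the two summands of the constant below bound the
   second-order errors of the penalty and of the squared distance across [u]. *)
pose C := n%:R * `|u| / U.
exists (k * N ^+ 2 * C ^+ 2 + lam * n%:R).
  by rewrite addr_ge0 // !(sqr_ge0, mulr_ge0) ?ler0n // ltW.
near=> y.
have y0 : 0 < along y.
  by near: y; apply: cvgr_gt z0; exact: along_cvg.
have : tilted f m k N lam z <= tilted f m k N lam y by near: y.
rewrite /tilted; set d := y - z.
have -> : y = z + d by rewrite addrC subrK.
rewrite sqr_acrossD alongD.
have zd0 : 0 < along z + dotp d u / U by rewrite -alongD /d addrC subrK.
have dC : (dotp d u / U) ^+ 2 <= C ^+ 2 * `|d| ^+ 2.
  have CE : C * `|d| = n%:R * `|d| * `|u| / U by rewrite /C; ring.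
  have C0 : 0 <= C by rewrite divr_ge0 ?(ltW U_gt0) // mulr_ge0.
  have Cd0 : 0 <= C * `|d| by exact: mulr_ge0.
  rewrite -exprMn -[leLHS]real_normK ?num_real // ler_sqr ?nnegrE //.
  rewrite CE normrM [`|U^-1|]gtr0_norm ?invr_gt0 // ler_pM2r ?invr_gt0 //.
  exact: norm_dotp_le.
have ddn : dotp d d <= n%:R * `|d| ^+ 2.
  by rewrite expr2 mulrA; apply: le_trans (norm_dotp_le _ _); exact: ler_norm.
have dE : dotp ((c / U) *: u - (2 * lam) *: across z) d =
    c * (dotp d u / U) - 2 * lam * dotp (across z) d.
  by rewrite dotpDl dotpNl !dotpZl (dotpC u d); ring.
rewrite dE; move: zd0 dC; move: (dotp d u / U) => t zd0 dC.
have Nay : 0 < 1 + N * (along z + t) by rewrite addr_gt0 // mulr_gt0.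
have kE : k / (1 + N * (along z + t)) <=
    k / (1 + N * along z) - k * N / (1 + N * along z) ^+ 2 * t
      + k * N ^+ 2 * t ^+ 2.
  (* Exact expansion to second order in [t]; the last factor is at most 1 because both
     [1 + N * along z] and [1 + N * (along z + t)] are at least 1. *)
  have -> : k / (1 + N * (along z + t)) =
    k / (1 + N * along z) - k * N / (1 + N * along z) ^+ 2 * t
      + k * N ^+ 2 * t ^+ 2 *
        ((1 + N * along z) ^+ 2 * (1 + N * (along z + t)))^-1.
    by field; rewrite !gt_eqF.
  rewrite lerD2l; apply: ler_piMr; first by rewrite !(sqr_ge0, mulr_ge0) // ltW.
  rewrite invf_le1 ?mulr_gt0 ?exprn_gt0 //.
  have h1 : 1 <= 1 + N * along z by rewrite lerDl mulr_ge0 ?ltW.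
  apply: mulr_ege1; first by rewrite exprn_ege1.
  by rewrite lerDl mulr_ge0 ?ltW.
have t2 : k * N ^+ 2 * t ^+ 2 <= k * N ^+ 2 * (C ^+ 2 * `|d| ^+ 2).
  by rewrite ler_wpM2l // !(sqr_ge0, mulr_ge0) // ltW.
have l1 : lam * dotp d d <= lam * (n%:R * `|d| ^+ 2) by rewrite ler_wpM2l // ltW.
have l2 : 0 <= lam * (t ^+ 2 * U) by rewrite !(sqr_ge0, mulr_ge0) // ltW.
by rewrite /c; nra.
Unshelve. all: by end_near.
Qed.
End MeanValue.

Lemma prox_mean_value {R : realType} {n : nat} (f : 'rV[R]_n -> R)
    (x u : 'rV[R]_n) (L r s m : R) :
  u != 0 -> 0 <= L -> 0 < s -> s * `|u| < r ->
  (forall a b, `|a - x| < r -> `|b - x| < r -> `|f a - f b| <= L * `|a - b|) ->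
  s * m < f (x + s *: u) - f x ->
  exists z v, [/\ `|z - x| < r, prox_subgrad f z v & m <= dotp v u].
Proof.
move=> u0 L0 s0 sr fL sm.
(* Half of the excess growth: the penalty, worth at most [k], cannot cancel the excess [2 k]. *)
pose k := (f (x + s *: u) - f x - s * m) / 2.
have k0 : 0 < k by rewrite divr_gt0 // subr_gt0.
(* Chosen so that on [[0, 1/N]] the penalty falls at average rate at least
   [k N / 2 = L |u| + |m| + 1], faster than [f - m * along] can grow. *)
pose N := 2 * (L * `|u| + `|m| + 1) / k.
have N0 : 0 < N by rewrite divr_gt0 // mulr_gt0 // ltr_wpDl // addr_ge0 // mulr_ge0.
(* With this radius the tube [A] stays in the ball where [f] is [L]-Lipschitz. *)
pose eta := (r - s * `|u|) / 2.
have eta0 : 0 < eta by rewrite divr_gt0 // subr_gt0.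
(* The first summand serves to exclude the face [al = s], the second the lateral face. *)
pose lam := L ^+ 2 / k + (L + 1) / eta.
have lam1 : L < lam * eta.
  rewrite /lam mulrDl divfK ?gt_eqF //.
  have : 0 <= L ^+ 2 / k * eta.
    by apply: mulr_ge0 (ltW eta0); apply: divr_ge0 (ltW k0); exact: sqr_ge0.
  by lra.
have lam0 : 0 < lam by rewrite -(pmulr_lgt0 _ eta0) (le_lt_trans L0).
pose al := along x u; pose ac := across x u.
pose A := [set y | [/\ 0 <= al y, al y <= s & `|ac y| <= eta]].
have Ar y : A y -> `|y - x| < r.
  move=> [a0 a1 ay]; have -> : y - x = al y *: u + ac y.
    by rewrite /ac /across -/al [RHS]addrC subrK.
  apply: le_lt_trans (ler_normD _ _) _.
  rewrite normrZ ger0_norm //.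
  have : al y * `|u| <= s * `|u| by rewrite ler_wpM2r.
  by move: sr ay; rewrite /eta; lra.
have A_line t : 0 <= t <= s -> A (x + t *: u).
  move=> /andP[t0 ts]; rewrite /A /al /ac /= along_line // across_line // normr0.
  by split=> //; exact: ltW.
have fA y : A y -> {for y, continuous f}.
  move=> Ay; apply: (@cvgrPdist_lt _ _ _ (nbhs y) _ f (f y)).2 => e e0.
  near=> z.
  have zr : `|z - x| < r.
    near: z; exact: (cvgr_norm_lt _ (cvgB cvg_id (cvg_cst x)) _ (Ar _ Ay)).
  apply: le_lt_trans (fL _ _ (Ar _ Ay) zr) _.
  rewrite -(@ltr_pM2l _ (L + 1)^-1) ?invr_gt0 ?ltr_wpDl //.
  apply: (@le_lt_trans _ _ `|y - z|).
    by rewrite mulrC ler_pdivrMr ?ltr_wpDl // mulrC ler_wpM2l // lerDl.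
  near: z; apply: cvgr_dist_lt; first exact: cvg_id.
  by rewrite mulr_gt0 ?invr_gt0 ?ltr_wpDl.
pose Phi := tilted x u f m k N lam.
have PhiA y : A y -> {for y, continuous Phi}.
  move=> Ay; have [y0 _ _] := Ay.
  (* The pole of the penalty, at [al y = - 1/N], lies outside [A]. *)
  have Ny : 1 + N * al y != 0 by rewrite gt_eqF // ltr_wpDr // mulr_ge0 // ltW.
  have alc := along_cvg x u y; have acc := across_cvg x u y.
  have mc : m * along x u y @[y --> y] --> m * al y.
    exact: (cvgMl_tmp alc).
  have Nc : (1 + N * along x u y) @[y --> y] --> 1 + N * al y.
    exact: (cvgD (cvg_cst (1 : R)) (cvgMl_tmp alc)).
  have kc : k / (1 + N * along x u y) @[y --> y] --> k / (1 + N * al y).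
    exact: (cvgMl_tmp (cvgV Ny Nc)).
  have fc : f z @[z --> y] --> f y := fA y Ay.
  have dc : lam * dotp (across x u z) (across x u z) @[z --> y]
      --> lam * dotp (across x u y) (across x u y).
    exact: (cvgMl_tmp (cvg_dotp acc acc)).
  exact: (cvgD (cvgD (cvgB fc mc) kc) dc).
have cA : compact A.
  apply: bounded_closed_compact.
    exists (r + `|x|); split=> [|M rM y Ay]; first exact: num_real.
    apply: le_trans (ltW rM); rewrite -[y](subrK x).
    by apply: le_trans (ler_normD _ _) _; rewrite lerD2r ltW // Ar.
  have -> : A = (al @^-1` [set t | 0 <= t]) `&` (al @^-1` [set t | t <= s]) `&`
      ((fun y => `|ac y|) @^-1` [set t | t <= eta]).
    by apply/seteqP; split=> y /=; [move=> [? ? ?]|move=> [[? ?] ?]].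
  apply: closedI; first apply: closedI; apply: preimage_closed => //.
  - by move=> y _; exact: along_cvg.
  - by move=> y _; exact: along_cvg.
  - by move=> y _; exact: (cvg_norm (across_cvg x u y)).
have Ax : A x.
  by have := A_line 0; rewrite scale0r addr0; apply; rewrite lexx ltW.
have [z + zmin] : exists2 z, z \in A & forall y, y \in A -> Phi z <= Phi y.
  apply: EVT_min_rV => //; first by exists x.
  by apply: continuous_in_subspaceT => y /set_mem; exact: PhiA.
move=> /set_mem Az; have [z0 zs zeta] := Az.
have PhiE t : 0 <= t -> Phi (x + t *: u) = f (x + t *: u) - m * t + k / (1 + N * t).
  move=> t0; rewrite /Phi /tilted along_line // across_line // /dotp.
  by rewrite big1 ?mulr0 ?addr0 // => j _; rewrite mxE mul0r.
have PhiZ : Phi z = f z - m * al z + k / (1 + N * al z) + lam * dotp (ac z) (ac z).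
  by [].
have acz2 := sqr_norm_le_dotp (ac z).
have zline : `|z - (x + al z *: u)| = `|ac z|.
  by rewrite /ac /across opprD addrA.
have Aal : A (x + al z *: u) by apply: A_line; rewrite z0.
have fzal : f (x + al z *: u) - L * `|ac z| <= f z.
  have := fL _ _ (Ar _ Aal) (Ar _ Az).
  by rewrite (distrC (x + _)) zline ler_norml => /andP[_]; lra.
(* Lateral face: comparison with the foot of [z] on the segment gives [lam |ac z|^2 <= L |ac z|],
   against [L < lam * eta]. *)
have zlt : `|ac z| < eta.
  rewrite ltNge; apply/negP => ge_eta.
  have := zmin _ (mem_set Aal); rewrite PhiZ PhiE // => zal.
  have h1 : lam * `|ac z| ^+ 2 <= L * `|ac z|.
    have : lam * `|ac z| ^+ 2 <= lam * dotp (ac z) (ac z) by rewrite ler_pM2l.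
    by lra.
  have a0 : 0 < `|ac z| by exact: lt_le_trans ge_eta.
  have : lam * `|ac z| <= L by rewrite -(ler_pM2r a0) -mulrA -expr2.
  have : lam * eta <= lam * `|ac z| by rewrite ler_pM2l.
  by lra.
(* Far face: comparison with [x] would require [k - L a + (L^2 / k) a^2 < 0] for [a = |ac z|], but
   completing the square shows that this quadratic is nonnegative. *)
have zls : al z < s.
  rewrite lt_neqAle zs andbT; apply/eqP => als.
  have := PhiE 0 (lexx 0); rewrite scale0r addr0 !mulr0 addr0 subr0 divr1 => Phix.
  have := zmin _ (mem_set Ax); rewrite PhiZ Phix als => zx.
  have p0 : 0 < k / (1 + N * s) by rewrite divr_gt0 // ltr_wpDr // mulr_ge0 // ltW.
  have h1 : lam * `|ac z| ^+ 2 <= lam * dotp (ac z) (ac z) by rewrite ler_pM2l.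
  have h2 : L ^+ 2 / k * `|ac z| ^+ 2 <= lam * `|ac z| ^+ 2.
    by rewrite ler_wpM2r ?sqr_ge0 // lerDl divr_ge0 ?addr_ge0 // ltW.
  have h3 : 0 <= L ^+ 2 / k * `|ac z| ^+ 2 - L * `|ac z| + k.
    have -> : L ^+ 2 / k * `|ac z| ^+ 2 - L * `|ac z| + k =
      ((L * `|ac z| - k / 2) ^+ 2 + 3 / 4 * k ^+ 2) / k by field; rewrite gt_eqF.
    by rewrite divr_ge0 ?(ltW k0) // addr_ge0 ?sqr_ge0 // mulr_ge0 // sqr_ge0.
  have kE : 2 * k = f (x + s *: u) - f x - s * m by rewrite /k; field.
  by move: fzal; rewrite als; lra.
(* Near face: a shift by [h *: u] keeps [ac] fixed and lowers the penalty by at least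
   [h (L |u| + |m| + 1)], so it would decrease [Phi]. *)
have zgt : 0 < al z.
  rewrite lt_neqAle z0 andbT; apply/negP => /eqP alz0.
  pose h := Num.min s N^-1.
  have h0 : 0 < h by rewrite lt_min s0 invr_gt0.
  have hs : h <= s by rewrite ge_min lexx.
  have hu : dotp (h *: u) u / dotp u u = h.
    by rewrite -{2}(along_line x u u0 h) /along addrC addKr.
  have alh : al (z + h *: u) = h by rewrite /al alongD hu -/al -alz0 add0r.
  have ach : ac (z + h *: u) = ac z by rewrite /ac acrossD hu subrr addr0.
  have Ah : A (z + h *: u) by split; rewrite ?alh ?ach // ltW.
  have := zmin _ (mem_set Ah).
  have -> : Phi (z + h *: u) = f (z + h *: u) - m * h + k / (1 + N * h)
      + lam * dotp (ac z) (ac z) by rewrite /Phi /tilted -/al -/ac alh ach.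
  rewrite PhiZ -alz0 !mulr0 addr0 subr0 divr1.
  have := fL _ _ (Ar _ Ah) (Ar _ Az).
  rewrite addrAC subrr add0r normrZ (gtr0_norm h0) ler_norml => /andP[_ fh].
  have Nh : N * h <= 1 by rewrite mulrC -ler_pdivlMr // div1r ge_min lexx orbT.
  have Nh0 : 0 < 1 + N * h by rewrite ltr_wpDr // mulr_ge0 // ltW.
  have kN : k * N = 2 * (L * `|u| + `|m| + 1) by rewrite /N; field; rewrite gt_eqF.
  have kh : k / (1 + N * h) <= k - h * (L * `|u| + `|m| + 1).
    rewrite ler_pdivrMr //.
    have : 0 <= h * (L * `|u| + `|m| + 1) * (1 - N * h).
      by rewrite mulr_ge0 ?subr_ge0 // mulr_ge0 ?(ltW h0) // !addr_ge0 // mulr_ge0.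
    have : k * (N * h) = 2 * (h * (L * `|u| + `|m| + 1)) by rewrite mulrA kN; ring.
    by lra.
  have : 0 <= h * (`|m| + m).
    by rewrite mulr_ge0 ?(ltW h0) // -lerBlDr sub0r -normrN ler_norm.
  by lra.
have [v fzv mv] : exists2 v, prox_subgrad f z v & m <= dotp v u.
  (* All three faces being excluded, points near [z] belong to [A], and the minimum over [A] is a
     local minimum. *)
  apply: (@prox_subgrad_tilted _ _ x u u0 f m k N lam z k0 N0 lam0 zgt).
  near=> y; apply: zmin; apply/mem_set; split; apply: ltW; near: y.
  - by apply: cvgr_gt zgt; exact: along_cvg.
  - by apply: cvgr_lt zls; exact: along_cvg.
  - by apply: cvgr_norm_lt zlt; exact: across_cvg.
by exists z, v; split => //; exact: Ar.
Unshelve. all: by end_near.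
Qed.

(** * Passage to the limit in proximal subgradients *)

Lemma norm_row_mx_le (R : realType) (m n : nat) (a : 'rV[R]_m) (b : 'rV[R]_n) :
  `|row_mx a b| <= `|a| + `|b|.
Proof.
have [->|/norm_coord[j ->]] := eqVneq (row_mx a b) 0.
  by rewrite normr0 addr_ge0.
case: (split_ordP j) => i ->; rewrite ?row_mxEl ?row_mxEr.
  by apply: le_trans (coord_le_norm _ _) _; rewrite lerDl.
by apply: le_trans (coord_le_norm _ _) _; rewrite lerDr.
Qed.

Lemma cvg_row_mx (R : realType) (m n : nat) (T : Type) (F : set_system T)
    {FF : Filter F} (f : T -> 'rV[R]_m) (h : T -> 'rV[R]_n)
    (a : 'rV[R]_m) (b : 'rV[R]_n) :
  f @ F --> a -> h @ F --> b -> row_mx (f t) (h t) @[t --> F] --> row_mx a b.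
Proof.
move=> fa hb; apply/cvgrPdist_lt => e e0; near=> t.
rewrite opp_row_mx add_row_mx; apply: le_lt_trans (norm_row_mx_le _ _ _ _ _) _.
rewrite [e]splitr; apply: ltrD.
  by near: t; apply: cvgr_dist_lt => //; rewrite divr_gt0.
by near: t; apply: cvgr_dist_lt => //; rewrite divr_gt0.
Unshelve. all: by end_near.
Qed.

Lemma cvg_invS_bound (R : realType) (V : normedModType R) (a : nat -> V) (l : V) :
  (forall k, `|a k - l| <= k.+1%:R^-1) -> a @ \oo --> l.
Proof.
move=> al; apply/cvgrPdist_lt => e e0; near=> k.
rewrite distrC; apply: le_lt_trans (al k) _.
by near: k; apply: near_infty_natSinv_lt (PosNum e0).
Unshelve. all: by end_near.
Qed.

Lemma C11_lipschitz_ball (R : realType) (n : nat) (f : 'rV[R]_n -> R) x :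
  C11 f -> exists r L : R, [/\ 0 < r, 0 <= L &
    forall a b, `|a - x| < r -> `|b - x| < r ->
      `|grad f a - grad f b| <= L * `|a - b|].
Proof.
move=> [_ /(_ x)[V /nbhs_ballP[r /= r0 rV] /pinfty_ex_gt0[L L0 fL]]].
exists r, L; split => //; first exact: ltW.
move=> a b ar br; apply: (fL (a, b)).
by split; apply: rV; rewrite -ball_normE /= distrC.
Qed.

(** Testing the proximal inequality at distance [a] from [z] in direction [v] gives
    [a |v| <= L a + K a^2]. The choice [a <= 1/(K + 1)] makes [K a <= 1], whence the summand 1 in
    the bound, which is independent of [K]. *)
Lemma prox_subgrad_norm_le (R : realType) (n : nat) (f : 'rV[R]_n -> R)
    (z v : 'rV[R]_n) (L r : R) :
  0 <= L -> 0 < r ->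
  (forall b, `|b - z| < r -> `|f b - f z| <= L * `|b - z|) ->
  prox_subgrad f z v -> `|v| <= L + 1.
Proof.
move=> L0 r0 fL [K K0 /nbhs_ballP[d /= d0 dK]].
have [->|v0] := eqVneq v 0; first by rewrite normr0 addr_ge0.
have nv0 : 0 < `|v| by rewrite normr_gt0.
have K1 : 0 < K + 1 by rewrite ltr_wpDl.
pose a := Num.min (Num.min d r / 2) (K + 1)^-1.
have a0 : 0 < a by rewrite lt_min invr_gt0 K1 divr_gt0 // lt_min d0.
have adr : a < Num.min d r.
  apply: (@le_lt_trans _ _ (Num.min d r / 2)); first by rewrite ge_min lexx.
  by rewrite gtr_pMr ?invf_lt1 ?ltr1n // lt_min d0.
have [ad ar] : a < d /\ a < r by move: adr; rewrite lt_min => /andP[].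
pose y := z + (a / `|v|) *: v.
have yz : y - z = (a / `|v|) *: v by rewrite /y addrC addKr.
have nyz : `|y - z| = a.
  by rewrite yz normrZ ger0_norm ?divfK ?gt_eqF // divr_ge0 // ltW.
have : ball z d y by rewrite -ball_normE /= distrC nyz.
move=> /dK; rewrite nyz yz dotpZr => fy.
have := fL y; rewrite nyz => /(_ ar); rewrite ler_norml => /andP[_ fyz].
have vv : a * `|v| <= a / `|v| * dotp v v.
  have -> : a * `|v| = a / `|v| * `|v| ^+ 2 by field; rewrite gt_eqF.
  by rewrite ler_pM2l ?divr_gt0 // sqr_norm_le_dotp.
have Ka : K * a <= 1.
  apply: (@le_trans _ _ ((K + 1) * a)); first by rewrite ler_pM2r // lerDl.
  by rewrite mulrC -ler_pdivlMr // div1r ge_min lexx orbT.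
have : a * `|v| <= a * (L + 1).
  have : K * a * a <= a by rewrite ler_piMl // ltW.
  by move: fy fyz vv; rewrite /=; lra.
by rewrite ler_pM2l.
Qed.

(** The bound [B] yields a cluster point [v] of the subgradients by compactness; the Frechet normals
    [(v_k, -u)] converge to [(v, -u)] along a subsequence, and [m <= <v_k, u>] is a closed
    condition. *)
Lemma limiting_normal_of_prox_subgrad (R : realType) (n : nat)
    (F : 'rV[R]_n -> 'rV[R]_n) (x u : 'rV[R]_n) (B m : R) :
  {for x, continuous F} ->
  (forall d : R, 0 < d -> exists z v,
    [/\ `|z - x| < d, prox_subgrad (fun y => dotp u (F y)) z v,
        `|v| <= B & m <= dotp v u]) ->
  exists v, limiting_normal_cone (row_mx x (F x)) (gph F) (row_mx v (- u)) /\
    m <= dotp v u.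
Proof.
move=> Fx H.
have /choice[zv zvP] (k : nat) : exists q : 'rV[R]_n * 'rV[R]_n,
    [/\ `|q.1 - x| < k.+1%:R^-1, prox_subgrad (fun y => dotp u (F y)) q.1 q.2,
        `|q.2| <= B & m <= dotp q.2 u].
  by have [|z [v ?]] := H k.+1%:R^-1; [rewrite invr_gt0|exists (z, v)].
pose v_ k := (zv k).2.
have cB : compact [set v : 'rV[R]_n | `|v| <= B].
  apply: bounded_closed_compact.
    exists B; split=> [|M BM y /= yB]; first exact: num_real.
    exact: le_trans (ltW BM).
  apply: (@preimage_closed _ _ (fun v : 'rV[R]_n => `|v|) [set t | t <= B]).
    by move=> y _; exact: norm_continuous.
  exact: closed_le.
have [v [_ vcl]] : [set v : 'rV[R]_n | `|v| <= B] `&` cluster (v_ @ \oo) !=set0.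
  by apply: cB; exists 0%N => // k _ /=; have [] := zvP k.
(* The condition [k <= j] keeps the base points within [1/(k + 1)] of [x]. *)
have /choice[j jP] (k : nat) : exists j, (k <= j)%N /\ `|v_ j - v| < k.+1%:R^-1.
  have vk : (v_ @ \oo) (v_ @` [set j | (k <= j)%N]).
    by exists k => // j kj; exists j.
  have k0 : 0 < k.+1%:R^-1 :> R by rewrite invr_gt0.
  have [_ [[j kj <-] vj]] := vcl _ _ vk (nbhsx_ballx v _ k0).
  by exists j; split; rewrite // distrC; move: vj; rewrite -ball_normE.
have vv : v_ (j k) @[k --> \oo] --> v.
  by apply: cvg_invS_bound => k; have [_ /ltW] := jP k.
have zx : (zv (j k)).1 @[k --> \oo] --> x.
  apply: cvg_invS_bound => k; have [kj _] := jP k; have [zx _ _ _] := zvP (j k).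
  by apply: le_trans (ltW zx) _; rewrite lef_pV2 ?posrE // ler_nat.
exists v; split.
  exists (fun k => row_mx (zv (j k)).1 (F (zv (j k)).1)).
  exists (fun k => row_mx (v_ (j k)) (- u)); split.
  - by move=> k; exists (zv (j k)).1.
  - apply: cvg_row_mx => //; exact: (cvg_comp _ F zx).
  - by apply: cvg_row_mx => //; exact: cvg_cst.
  - by move=> k; apply: prox_subgrad_frechet_normal; have [] := zvP (j k).
rewrite leNgt; apply/negP => vm.
have vu : dotp (v_ (j k)) u @[k --> \oo] --> dotp v u.
  exact: (cvg_dotp vv (cvg_cst u)).
near \oo => k.
have : dotp (v_ (j k)) u < m by near: k; exact: (cvgr_lt _ vu).
by apply/negP; rewrite -leNgt; have [] := zvP (j k).
Unshelve. all: by end_near.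
Qed.

(** * Growth of the scalarised gradient along [u] *)

Lemma cvg_grad (R : realType) (n : nat) (f : 'rV[R]_n -> R) x :
  C11 f -> grad f y @[y --> x] --> grad f x.
Proof.
move=> /(C11_lipschitz_ball _ _ _ x)[r [L [r0 L0 fL]]].
apply: (@cvgrPdist_lt _ _ _ (nbhs x) _ (grad f) (grad f x)).2 => e e0.
near=> y.
have xy : `|x - y| < Num.min r (e / (L + 1)).
  near: y; apply: cvgr_dist_lt; first exact: cvg_id.
  by rewrite lt_min r0 divr_gt0 // ltr_wpDl.
have [xyr xye] : `|x - y| < r /\ `|x - y| < e / (L + 1).
  by move: xy; rewrite lt_min => /andP[].
apply: (@le_lt_trans _ _ (L * `|x - y|)).
  by apply: fL; [rewrite subrr normr0|rewrite distrC].
apply: (@le_lt_trans _ _ ((L + 1) * `|x - y|)).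
  by rewrite ler_wpM2r // lerDl.
by rewrite mulrC -ltr_pdivlMr // ltr_wpDl.
Unshelve. all: by end_near.
Qed.

(* Upper Dini estimate for the scalarised gradient: by the mean value
   inequality a larger growth rate along [u] would produce proximal subgradients
   accumulating at an element of [subdiff2] that beats [zeta]. *)
Lemma dotp_grad_upper_bound (R : realType) (n : nat) (f : 'rV[R]_n -> R)
    (x u zeta : 'rV[R]_n) (e : R) :
  C11 f -> is_max_subgrad2 f x u zeta -> 0 < e ->
  \forall s \near 0^'+,
    dotp u (grad f (x + s *: u)) - dotp u (grad f x) <= s * (dotp zeta u + e).
Proof.
move=> fC [_ zmax] e0.
have [u0|u0] := eqVneq u 0.
  near=> s; have s0 : 0 < s by near: s; exact: nbhs_right_gt.
  rewrite u0 scaler0 addr0 subrr mulr_ge0 ?ltW //.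
  by rewrite /dotp big1 ?add0r // => j _; rewrite mxE mulr0.
have [r [L [r0 L0 fL]]] := C11_lipschitz_ball _ _ _ x fC.
pose psi y := dotp u (grad f y).
pose L' := n%:R * `|u| * L.
have L'0 : 0 <= L' by rewrite /L' !mulr_ge0.
have psiL a b : `|a - x| < r -> `|b - x| < r -> `|psi a - psi b| <= L' * `|a - b|.
  move=> ar br; rewrite /psi -dotpNr -dotpDr.
  apply: le_trans (norm_dotp_le _ _) _.
  by rewrite /L' -(mulrA _ L); apply: ler_wpM2l; [rewrite mulr_ge0|exact: fL].
apply: contrapT => nH.
have H s1 : 0 < s1 -> exists s, [/\ 0 < s, s < s1 &
    s * (dotp zeta u + e) < psi (x + s *: u) - psi x].
  move=> s10; apply: contrapT => nex; apply: nH; near=> s.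
  have s0 : 0 < s by near: s; exact: nbhs_right_gt.
  have ss1 : s < s1 by near: s; exact: nbhs_right_lt.
  by rewrite leNgt; apply/negP => lt_s; apply: nex; exists s.
have nu0 : 0 < `|u| by rewrite normr_gt0.
have [] := limiting_normal_of_prox_subgrad _ _ (grad f) x u (L' + 1)
  (dotp zeta u + e) (cvg_grad _ _ _ x fC).
  move=> d d0; pose c := Num.min d r.
  have c0 : 0 < c by rewrite lt_min d0.
  have [s [s0 sc sx]] := H (c / `|u|) (divr_gt0 c0 nu0).
  have suc : s * `|u| < c by rewrite -ltr_pdivlMr.
  have cr b : `|b - x| < c -> `|b - x| < r.
    by move=> bc; apply: lt_le_trans bc _; rewrite ge_min lexx orbT.
  have [] := prox_mean_value psi x u L' c s (dotp zeta u + e) u0 L'0 s0 suc _ sx.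
    by move=> a b /cr ar /cr br; exact: psiL.
  move=> z [v [zc zv vu]]; exists z, v; split => //.
    by apply: lt_le_trans zc _; rewrite ge_min lexx.
  (* The ball of this radius around [z] stays in the ball around [x] where [psi] is [L']-Lipschitz,
     so the bound [L' + 1] is the same for every [d]. *)
  have cz0 : 0 < c - `|z - x| by rewrite subr_gt0.
  apply: (prox_subgrad_norm_le _ _ psi z v L' _ L'0 cz0) => // b bz.
  apply: psiL; last exact: cr.
  apply: cr; rewrite -[b](subrK z) -addrA.
  by apply: le_lt_trans (ler_normD _ _) _; move: bz; rewrite ltrBrDr.
move=> v [/zmax vM]; apply/negP; rewrite -ltNge.
by apply: le_lt_trans vM _; rewrite ltrDl.
Unshelve. all: by end_near.
Qed.

(** * Calculus along the parabolic arc *)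

Section Arc.
Context {R : realType} {n : nat}.
Implicit Types (f : 'rV[R]_n -> R) (x u w : 'rV[R]_n) (t s : R).

Definition arc x u w t : 'rV[R]_n := x + t *: u + (2^-1 * t ^+ 2) *: w.

Lemma arc0 x u w : arc x u w 0 = x.
Proof. by rewrite /arc expr0n mulr0 !scale0r !addr0. Qed.

Lemma is_diff_arc x u w t :
  is_diff t (arc x u w) (fun h => h *: (u + t *: w)).
Proof.
have k' : is_derive t 1 (fun s : R => 2^-1 * s ^+ 2) t.
  by apply: is_derive_eq; rewrite /GRing.scale /=; field.
have dk : differentiable (fun s : R => 2^-1 * s ^+ 2) t.
  by apply/derivable1_diffP.
have kE h : 'd (fun s : R => 2^-1 * s ^+ 2) t h = h * t.
  rewrite -[h in LHS]mulr1 -[h * 1]/(h *: 1) linearZ /= -deriveE //.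
  by rewrite derive_val.
have dw : is_diff t (fun s : R => (2^-1 * s ^+ 2) *: w) (fun h => (h * t) *: w).
  apply: DiffDef; first exact: differentiableZl.
  by rewrite diffZl //; apply/funext => h /=; rewrite kE.
have -> : (fun h => h *: (u + t *: w)) =
    (0 : R -> 'rV[R]_n) + ( *:%R ^~ u) + (fun h => (h * t) *: w).
  by apply/funext => h; rewrite !fctE add0r scalerDr scalerA.
exact: (is_diffD (is_diffD (is_diff_cst x t) (is_diff_scalel t u)) dw).
Qed.

Lemma cvg_arc x u w : arc x u w t @[t --> 0^'+] --> x.
Proof.
apply: cvg_at_right_filter; rewrite -{2}(arc0 x u w).
have [da _] := is_diff_arc x u w 0.
exact: differentiable_continuous da.
Qed.

Lemma is_derive_arc f x u w t : differentiable f (arc x u w t) ->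
  is_derive t 1 (f \o arc x u w) (dotp (grad f (arc x u w t)) (u + t *: w)).
Proof.
move=> df; have da := is_diff_arc x u w t.
have dc : differentiable (f \o arc x u w) t by apply: differentiable_comp.
apply: DeriveDef; first exact/derivable1_diffP.
rewrite deriveE // diff_comp //= diff_val scale1r; exact: grad_dotp.
Qed.

(** By the mean value theorem on [[0, s]], the increment of [f] along the arc from its starting
    value [f x] is [s] times a nonpositive derivative. *)
Lemma arc_nonpos f x u w : (forall y, differentiable f y) -> f x <= 0 ->
  (\forall s \near 0^'+, dotp (grad f (arc x u w s)) (u + s *: w) <= 0) ->
  \forall s \near 0^'+, f (arc x u w s) <= 0.
Proof.
move=> df fx /nbhs_ballP[d /= d0 dP].
near=> s.
have s0 : 0 < s by near: s; exact: nbhs_right_gt.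
have sd : s < d by near: s; exact: nbhs_right_lt.
have fd (t : R) := is_derive_arc f x u w t (df _).
have fc : {within `[0, s], continuous (f \o arc x u w)}.
  apply: continuous_subspaceT => t.
  by apply/differentiable_continuous/derivable1_diffP; have [] := fd t.
have [c c0s] := MVT s0 (fun t _ => fd t) fc.
move: c0s; rewrite in_itv /= => /andP[c0 cs]; rewrite /= arc0 subr0 => fE.
have : dotp (grad f (arc x u w c)) (u + c *: w) <= 0.
  apply: dP => //; rewrite -ball_normE /= sub0r normrN gtr0_norm //.
  exact: lt_trans sd.
move=> gc; have : dotp (grad f (arc x u w c)) (u + c *: w) * s <= 0.
  by rewrite pmulr_lle0.
by rewrite -fE; move: fx; lra.
Unshelve. all: by end_near.
Qed.
End Arc.

(** * Feasibility of the arc for small parameters *)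

Section ArcFeasible.
Context {R : realType} {n : nat}.
Implicit Types (f : 'rV[R]_n -> R) (x u w : 'rV[R]_n) (t s : R).

Lemma arc_nonpos_inactive f x u w : C11 f -> f x < 0 ->
  \forall s \near 0^'+, f (arc x u w s) <= 0.
Proof.
move=> [df _] fx; have fc : f (arc x u w s) @[s --> 0^'+] --> f x.
  exact: (cvg_comp _ f (cvg_arc x u w) (differentiable_continuous (df x))).
by near=> s; apply: ltW; near: s; exact: (cvgr_lt _ fc).
Unshelve. all: by end_near.
Qed.

Lemma arc_nonpos_first_order f x u w : C11 f -> f x <= 0 ->
  dotp (grad f x) u < 0 -> \forall s \near 0^'+, f (arc x u w s) <= 0.
Proof.
move=> fC fx fu; apply: arc_nonpos => //; first exact: fC.1.
have gc : grad f (arc x u w s) @[s --> 0^'+] --> grad f x.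
  exact: (cvg_comp _ (grad f) (cvg_arc x u w) (cvg_grad _ _ f x fC)).
have uc : (u + s *: w) @[s --> 0^'+] --> u.
  apply: cvg_at_right_filter; rewrite -[X in _ --> X]addr0 -(scale0r w).
  exact: (cvgD (cvg_cst u) (cvgZr_tmp cvg_id)).
by near=> s; apply: ltW; near: s; exact: (cvgr_lt _ (cvg_dotp gc uc)).
Unshelve. all: by end_near.
Qed.

Lemma arc_nonpos_second_order f x u w zeta : C11 f -> f x <= 0 ->
  is_max_subgrad2 f x u zeta -> dotp (grad f x) u = 0 ->
  dotp (grad f x) w + dotp zeta u < 0 ->
  \forall s \near 0^'+, f (arc x u w s) <= 0.
Proof.
move=> fC fx fzeta fu fw; apply: arc_nonpos => //; first exact: fC.1.
(* Isolated because [lra] would otherwise compare the gradients at different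
   points by unfolding them. *)
have lin (A B C D E G Z s : R) : A <= B + C * s ^+ 2 -> B <= s * (Z + E) ->
    s * D <= s * (G + E) -> C * s ^+ 2 <= s * E -> 0 < s * E ->
    s * (G + Z) = s * (- 4 * E) -> A + s * D <= 0.
  by move=> *; lra.
(* A quarter of the slack: the Dini estimate, the passage from line to arc, and the variation of the
   gradient against [w] cost [s * e] each, leaving a derivative of at most [- s * e]. *)
pose e := - (dotp (grad f x) w + dotp zeta u) / 4.
have e0 : 0 < e by rewrite divr_gt0 // oppr_gt0.
have [r [L [r0 L0 fL]]] := C11_lipschitz_ball _ _ _ x fC.
have dini := dotp_grad_upper_bound _ _ _ x u zeta e fC fzeta e0.
have gc : grad f (arc x u w s) @[s --> 0^'+] --> grad f x.
  exact: (cvg_comp _ (grad f) (cvg_arc x u w) (cvg_grad _ _ f x fC)).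
have gw : dotp (grad f (arc x u w s)) w @[s --> 0^'+] --> dotp (grad f x) w.
  exact: (cvg_dotp gc (cvg_cst w)).
have linear_ball y : \forall s \near 0^'+, `|arc x u y s - x| < r.
  have ax : (arc x u y s - x) @[s --> 0^'+] --> (0 : 'rV[R]_n).
    by rewrite -[X in _ --> X](subrr x); exact: (cvgB (cvg_arc x u y) (cvg_cst x)).
  by apply: (cvgr_norm_lt _ ax); rewrite normr0.
have ufx : dotp u (grad f x) = 0 by rewrite dotpC.
(* The arc is at distance [s^2 |w| / 2] from the point [x + s *: u], so replacing one by the other
   changes [<u, grad f>] by at most [C s^2]. *)
pose C := n%:R * `|u| * (L * (2^-1 * `|w|)).
have C0 : 0 <= C by rewrite /C !mulr_ge0 // invr_ge0.
have C1 : 0 < C + 1 by rewrite ltr_wpDl.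
near=> s.
have s0 : 0 < s by near: s; exact: nbhs_right_gt.
have sC : C * s <= e.
  apply: (@le_trans _ _ ((C + 1) * s)); first by rewrite ler_pM2r // lerDl.
  rewrite mulrC -ler_pdivlMr //; apply: ltW; near: s.
  exact: (nbhs_right_lt (divr_gt0 e0 C1)).
have gws : dotp (grad f (arc x u w s)) w < dotp (grad f x) w + e.
  by near: s; apply: (cvgr_lt _ gw); rewrite ltrDl.
have us : dotp u (grad f (x + s *: u)) <= s * (dotp zeta u + e).
  rewrite -[leLHS]subr0 -ufx; near: s; exact: dini.
have ww : `|arc x u w s - x| < r by near: s; exact: linear_ball.
have w0 : `|x + s *: u - x| < r.
  have -> : x + s *: u = arc x u 0 s by rewrite /arc scaler0 addr0.
  by near: s; exact: linear_ball.
have uarc : dotp u (grad f (arc x u w s)) <= dotp u (grad f (x + s *: u)) + C * s ^+ 2.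
  rewrite addrC -lerBlDr -dotpNr -dotpDr; apply: le_trans (ler_norm _) _.
  apply: le_trans (norm_dotp_le _ _) _; rewrite /C -(mulrA (n%:R * _)).
  apply: ler_wpM2l; first by rewrite mulr_ge0.
  apply: le_trans (fL _ _ ww w0) _.
  rewrite /arc [x + _ + _]addrC addrK normrZ -!mulrA ler_wpM2l // ger0_norm.
    by rewrite -mulrA ler_wpM2l ?invr_ge0 // mulrC.
  by rewrite mulr_ge0 ?invr_ge0 ?sqr_ge0.
have dw : s * dotp (grad f (arc x u w s)) w <= s * (dotp (grad f x) w + e).
  by rewrite (ler_pM2l s0) (ltW gws).
have Cs : C * s ^+ 2 <= s * e by rewrite expr2 mulrA mulrC (ler_pM2l s0) sC.
have e4 : dotp (grad f x) w + dotp zeta u = - 4 * e by rewrite /e; field.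
have se : 0 < s * e by rewrite mulr_gt0.
rewrite dotpDr dotpZr dotpC.
have se4 : s * (dotp (grad f x) w + dotp zeta u) = s * (- 4 * e) by rewrite e4.
exact: lin uarc us dw Cs se se4.
Unshelve. all: by end_near.
Qed.

(** Each constraint is inactive, decreasing to first order, or directionally active; finitely many
    indices permit a common range of [s]. *)
Lemma arc_feasible (p : nat) (g : 'I_p -> 'rV[R]_n -> R) x u w zeta :
  (forall i, C11 (g i)) -> feasible g x ->
  (forall i, active g x i -> is_max_subgrad2 (g i) x u (zeta i)) ->
  (forall i, active g x i -> dotp (grad (g i) x) u <= 0) ->
  (forall i, active_dir g x u i ->
    dotp (grad (g i) x) w + dotp (zeta i) u < 0) ->
  \forall s \near 0^'+, feasible g (arc x u w s).
Proof.
move=> gC gx gzeta gu gw; rewrite /feasible /=.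
apply: filter_forall => i.
have [gi0|gi0] := eqVneq (g i x) 0; last first.
  by apply: arc_nonpos_inactive => //; rewrite lt_neqAle gi0 gx.
have [giu|giu] := eqVneq (dotp (grad (g i) x) u) 0.
  apply: (arc_nonpos_second_order (g i) x u w (zeta i)) => //; first exact: gzeta.
  exact: gw (conj gi0 giu).
by apply: arc_nonpos_first_order => //; rewrite lt_neqAle giu gu.
Qed.
End ArcFeasible.

Theorem theorem3p4 (R : realType) (n p : nat) (g : 'I_p -> 'rV[R]_n -> R)
    (xbar u : 'rV[R]_n) (zeta : 'I_p -> 'rV[R]_n)
    (hg : forall i, C11 (g i))
    (hxbar : feasible g xbar)
    (hzeta : forall i, active g xbar i ->
       is_max_subgrad2 (g i) xbar u (zeta i))
    (hsys : exists w : 'rV[R]_n, forall i, active_dir g xbar u i ->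
       dotp (grad (g i) xbar) w + dotp (zeta i) u < 0) :
  L2 g zeta xbar u `<=` tangent2 (feasible g) xbar u.
Proof.
move=> v Lv; have [w hw] := hsys.
have Lvlex i : active g xbar i -> dotp (grad (g i) xbar) u <= 0 /\
    (0 <= dotp (grad (g i) xbar) u ->
      dotp (grad (g i) xbar) v + dotp (zeta i) u <= 0).
  by move=> /Lv; rewrite /G2 lexi_pair => /andP[? /implyP].
(* A convex combination giving [w] positive weight: the weak inequality for [v] and the strict one
   for [w] combine to a strict one. *)
pose v_ (k : nat) := v + k.+1%:R^-1 *: (w - v).
have feas k : \forall s \near 0^'+, feasible g (arc xbar u (v_ k) s).
  apply: arc_feasible hg hxbar hzeta _ _ => [i /Lvlex[]//|i ui].
  have [iact iu] := ui; have [_] := Lvlex i iact; rewrite iu lexx => /(_ isT) iv.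
  have iw := hw i ui.
  have l0 : 0 < k.+1%:R^-1 :> R by rewrite invr_gt0.
  have l1 : k.+1%:R^-1 <= 1 :> R by rewrite invf_le1 // ler1n.
  rewrite /v_ dotpDr dotpZr dotpDr dotpNr.
  move: (dotp _ v) (dotp _ w) (dotp _ u) (k.+1%:R^-1) iv iw l0 l1 => a b c l.
  by nra.
have /choice[d dP] k : exists d : R, [/\ 0 < d, d <= k.+1%:R^-1 &
    forall s, 0 < s -> s <= d -> feasible g (arc xbar u (v_ k) s)].
  have /nbhs_ballP[d /= d0 dk] := feas k.
  have k0 : 0 < k.+1%:R^-1 :> R by rewrite invr_gt0.
  exists (Num.min (d / 2) k.+1%:R^-1); split.
  - by rewrite lt_min k0 divr_gt0.
  - by rewrite ge_min lexx orbT.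
  - move=> s s0; rewrite le_min => /andP[sd _]; apply: dk => //.
    rewrite -ball_normE /= sub0r normrN gtr0_norm //.
    by apply: le_lt_trans sd _; rewrite gtr_pMr // invf_lt1 // ltr1n.
(* Running minimum of [d]: nonincreasing, and still at most [d k], hence a valid parameter for the
   arc of [v_ k]. *)
pose t_ := nat_rect (fun=> R) (d 0%N) (fun k t => Num.min t (d k.+1)).
have td k : t_ k <= d k by case: k => [|k] //=; rewrite ge_min lexx orbT.
have t0 k : 0 < t_ k.
  elim: k => [|k IH] /=; first by have [] := dP 0%N.
  by rewrite lt_min IH; have [] := dP k.+1.
exists t_, v_; split => //.
- by apply/nonincreasing_seqP => k /=; rewrite ge_min lexx.
- apply: cvg_invS_bound => k; rewrite subr0 gtr0_norm //.
  by apply: le_trans (td k) _; have [] := dP k.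
- rewrite -[X in _ --> X]addr0 -(scale0r (w - v)).
  have k0 : k.+1%:R^-1 @[k --> \oo] --> (0 : R).
    by apply: cvg_invS_bound => k; rewrite subr0 ger0_norm // invr_ge0.
  exact: (cvgD (cvg_cst v) (cvgZr_tmp k0)).
- by move=> k; have [_ _] := dP k; apply.
Qed.
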